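(* Let $\mathcal{A}$ be an associative unital algebra over $\mathbb{C}$ and let $B=(B_{ij})_{1\le i,j\le g}$ be a $g\times g$ matrix with entries in $\mathcal{A}$ such that entries in different rows commute: $[B_{ik},B_{jl}]=0$ whenever $i\neq j$ (for all $k,l$). Let $D\in\mathcal A$ be the determinant of $B$ and $\Delta_{ij}\in\mathcal A$ the signed cofactor of $B_{ij}$ (defined below). Assume $D$ is invertible in $\mathcal{A}$ and that $B$ is invertible in $\mathrm{Mat}_g(\mathcal{A})$. Then the inverse is given by $(B^{-1})_{ij}=D^{-1}\Delta_{ji}$, and elements in the same column of $B^{-1}$ commute: $$[(B^{-1})_{ir},(B^{-1})_{jr}]=0\qquad\text{for all } i,j,r\in\{1,\dots,g\}.$$ Equivalently, $\Delta_{ri}D^{-1}\Delta_{rj}=\Delta_{rj}D^{-1}\Delta_{ri}$ for all $i,j,r$.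
   Context: Because entries of $B$ lying in different rows commute, the determinant $D=\sum_{\sigma\in S_g}\mathrm{sgn}(\sigma)\,B_{1\sigma(1)}B_{2\sigma(2)}\cdots B_{g\sigma(g)}$ is independent of the order of the factors in each product. Likewise the cofactor $\Delta_{ij}$ is $(-1)^{i+j}$ times the determinant (defined the same way) of the $(g-1)\times(g-1)$ matrix obtained from $B$ by deleting row $i$ and column $j$; it is also well defined. *)

(* Defs.v *)
From HB Require Import structures.
From mathcomp Require Import all_boot all_order all_algebra all_fingroup.
From mathcomp Require Import complex.
From mathcomp Require Import Rstruct.
From Stdlib Require Import Reals.
Set Implicit Arguments.
Unset Strict Implicit.
Unset Printing Implicit Defensive.

Definition CC : fieldType := complex Rdefinitions.R.

(* Main.v *)
Require Import Defs.
From HB Require Import structures.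
From mathcomp Require Import all_boot all_order all_algebra all_fingroup.

Set Implicit Arguments.
Unset Strict Implicit.
Unset Printing Implicit Defensive.

Import GRing.Theory.
Local Open Scope ring_scope.

(* When entries in different rows commute, the factors of each Leibniz
   product pairwise commute, so the Laplace expansion along a column still
   holds. It gives [\adj B *m B = (\det B)%:M], hence [B^-1 = D^-1 *: \adj B].
   For the column commutation let [H k] be [B] with column [i] replaced by
   column [k] and row [r] replaced by the [j]-th unit row. Expanding along
   column [i], [\sum_k \det (H k) * (B^-1) k r] only involves the entries
   [(B *m B^-1) s r] with [s != r], so it vanishes. Only [k = i] and [k = j]
   contribute, with [\det (H i) = Delta_rj] and [\det (H j) = - Delta_ri],
   whence [Delta_rj D^-1 Delta_ri = Delta_ri D^-1 Delta_rj]. *)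

Section CommutingProducts.
Variable R : pzRingType.

Lemma prodr_rem_comm (I : eqType) (s : seq I) (F : I -> R) x :
  x \in s -> (forall j, j \in s -> F x * F j = F j * F x) ->
  \prod_(i <- s) F i = F x * \prod_(i <- rem x s) F i.
Proof.
elim: s => [//|y s IH]; rewrite inE big_cons /=.
case: eqP => [-> _ _ /=| /eqP neq_xy /= xs commFx]; first by rewrite eqxx.
rewrite eq_sym (negbTE neq_xy) big_cons IH //; last first.
  by move=> j js; apply: commFx; rewrite inE js orbT.
by rewrite !mulrA commFx // inE eqxx.
Qed.

Lemma perm_prodr_comm (I : eqType) (r1 r2 : seq I) (F : I -> R) :
  (forall i j, i \in r1 -> j \in r1 -> F i * F j = F j * F i) ->
  perm_eq r1 r2 -> \prod_(i <- r1) F i = \prod_(i <- r2) F i.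
Proof.
elim: r1 r2 => [|x r1 IH] r2 commF eq_r12.
  by move: eq_r12; rewrite perm_sym => /perm_nilP ->.
have xr2 : x \in r2 by rewrite -(perm_mem eq_r12) inE eqxx.
rewrite (prodr_rem_comm xr2); last first.
  by move=> j; rewrite -(perm_mem eq_r12); apply: commF; rewrite inE eqxx.
rewrite big_cons; congr (_ * _); apply: IH.
  by move=> i j ir jr; apply: commF; rewrite inE ?ir ?jr orbT.
by rewrite -(perm_cons x) (permPl eq_r12) perm_to_rem.
Qed.

Lemma prodr_lift_comm n (i0 : 'I_n.+1) (F : 'I_n.+1 -> R) :
  (forall a b, F a * F b = F b * F a) ->
  \prod_(k | i0 != k) F k = \prod_(k : 'I_n) F (lift i0 k).
Proof.
move=> commF; rewrite -big_filter -(big_map (lift i0) xpredT F).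
apply: perm_prodr_comm => [i j _ _ //|].
apply: uniq_perm.
- by rewrite filter_uniq // index_enum_uniq.
- by rewrite map_inj_uniq ?index_enum_uniq //; apply: lift_inj.
move=> k; rewrite mem_filter mem_index_enum andbT.
case: (unliftP i0 k) => [k'|] ->.
  by rewrite neq_lift; apply/esym/mapP; exists k' => //; rewrite mem_index_enum.
by rewrite eqxx; apply/esym/mapP => -[k' _ /eqP]; rewrite (negbTE (neq_lift _ _)).
Qed.

Lemma prodrD1_comm (I : finType) (F : I -> R) j :
  (forall a, F j * F a = F a * F j) ->
  \prod_(i : I) F i = (\prod_(i | j != i) F i) * F j.
Proof.
move=> commFj; rewrite (prodr_rem_comm (mem_index_enum j)) //.
rewrite rem_filter ?index_enum_uniq // big_filter.
rewrite (eq_bigl (fun i => j != i)) => [|i]; last by rewrite /= eq_sym.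
by apply: commr_prod => i _; apply: commFj.
Qed.

End CommutingProducts.

Lemma lift_eqF n (i : 'I_n) j : (lift i j == i) = false.
Proof. by rewrite eq_sym (negbTE (neq_lift _ _)). Qed.

Section RowCommutingDeterminant.
Variable R : pzRingType.
Implicit Types (n : nat).

Definition row_commuting n (M : 'M[R]_n) :=
  forall i j k l, i != j -> M i k * M j l = M j l * M i k.

Lemma expand_cofactor_rcomm n (M : 'M[R]_n) i j : row_commuting M ->
  cofactor M i j =
    \sum_(s : 'S_n | s i == j) (-1) ^+ s * \prod_(k | i != k) M k (s k).
Proof.
case: n M i j => [|n] M i0 j0 commM; first by case: i0.
rewrite (reindex (lift_perm i0 j0)); last first.
  pose ulsf i (s : 'S_n.+1) k := odflt k (unlift (s i) (s (lift i k))).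
  have ulsfK i (s : 'S_n.+1) k: lift (s i) (ulsf i s k) = s (lift i k).
    rewrite /ulsf; have:= neq_lift i k.
    by rewrite -(can_eq (permK s)) => /unlift_some[] ? ? ->.
  have inj_ulsf: injective (ulsf i0 _).
    move=> s; apply: can_inj (ulsf (s i0) s^-1%g) _ => k'.
    by rewrite {1}/ulsf ulsfK !permK liftK.
  exists (fun s => perm (inj_ulsf s)) => [s _ | s].
    by apply/permP=> k'; rewrite permE /ulsf lift_perm_lift lift_perm_id liftK.
  move/(s _ =P _) => si0; apply/permP=> k.
  case: (unliftP i0 k) => [k'|] ->; rewrite ?lift_perm_id //.
  by rewrite lift_perm_lift -si0 permE ulsfK.
rewrite /cofactor big_distrr /=.
apply: eq_big => [s | s _]; first by rewrite lift_perm_id eqxx.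
rewrite -signr_odd mulrA -signr_addb oddD -odd_lift_perm; congr (_ * _).
rewrite prodr_lift_comm; last first.
  move=> a b; have [->//|neq_ab] := eqVneq a b; exact: commM.
by apply: eq_bigr => k _; rewrite !mxE lift_perm_lift.
Qed.

Lemma expand_det_col_rcomm n (M : 'M[R]_n) j0 : row_commuting M ->
  \det M = \sum_i cofactor M i j0 * M i j0.
Proof.
move=> commM; rewrite /(\det M).
rewrite (partition_big (fun s : 'S_n => (s^-1)%g j0) predT) //=.
apply: eq_bigr => i0 _; rewrite expand_cofactor_rcomm // mulr_suml.
apply: eq_big => [s | s /eqP si0]; first by rewrite (canF_eq (permKV s)) eq_sym.
have {}si0 : s i0 = j0 by rewrite -si0 permKV.
rewrite -mulrA (prodrD1_comm (j := i0)) si0 // => a.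
have [->|neq_a] := eqVneq a i0; first by rewrite si0.
by rewrite -si0 commM // eq_sym.
Qed.

Lemma det_row0 n (M : 'M[R]_n) i : (forall k, M i k = 0) -> \det M = 0.
Proof.
move=> Mi0; apply: big1 => s _.
by rewrite (prodrD1_comm (j := i)) Mi0 ?mulr0 // => a; rewrite mul0r mulr0.
Qed.

Lemma det_col_perm n (M : 'M[R]_n) (p : 'S_n) :
  \det (col_perm p M) = (-1) ^+ p * \det M.
Proof.
rewrite /(\det (col_perm p M)) /(\det M) big_distrr /=.
rewrite [RHS](reindex_inj (mulIg p)); apply: eq_bigr => s _.
rewrite odd_permM signr_addb mulrA.
have -> : (-1) ^+ p * ((-1) ^+ s * (-1) ^+ p) = (-1) ^+ s :> R.
  by rewrite -!signr_addb; case: (odd_perm p); case: (odd_perm s).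
by congr (_ * _); apply: eq_bigr => k _; rewrite !mxE permM.
Qed.

Lemma determinant_alternate_col n (M : 'M[R]_n) i1 i2 :
  i1 != i2 -> (forall a, M a i1 = M a i2) -> \det M = 0.
Proof.
move=> neq_i12 eqM12; pose t := tperm i1 i2.
have oddMt s: (s * t)%g = ~~ s :> bool by rewrite odd_permM odd_tperm neq_i12 addbT.
rewrite [\det M](bigID (@odd_perm _)) /=.
apply: canLR (subrK _) _; rewrite add0r -sumrN.
rewrite (reindex_inj (mulIg t)); apply: eq_big => //= s _.
rewrite oddMt signrN mulNr; congr (- (_ * _)).
by apply: eq_bigr => k _; rewrite permM /t; case: tpermP => // ->.
Qed.

Lemma eq_cofactor_col n (M N : 'M[R]_n) s i :
  (forall a b, b != i -> M a b = N a b) -> cofactor M s i = cofactor N s i.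
Proof.
move=> eqMN; rewrite /cofactor; congr (_ * \det _).
by apply/matrixP => a b; rewrite !mxE eqMN // lift_eqF.
Qed.

Lemma eq_cofactor_row n (M N : 'M[R]_n) r j :
  (forall a b, a != r -> M a b = N a b) -> cofactor M r j = cofactor N r j.
Proof.
move=> eqMN; rewrite /cofactor; congr (_ * \det _).
by apply/matrixP => a b; rewrite !mxE eqMN // lift_eqF.
Qed.

Lemma det_delta_row_rcomm n (M : 'M[R]_n) r j : row_commuting M ->
  (forall k, M r k = (k == j)%:R) -> \det M = cofactor M r j.
Proof.
move=> commM Mr; rewrite (expand_det_col_rcomm j commM) (bigD1 r) //=.
rewrite Mr eqxx mulr1 big1 ?addr0 // => s neq_sr.
have [r' Er] : exists r', r = lift s r'.
  by case: (unliftP s r) => [r' ->|Ers]; [exists r' | rewrite Ers eqxx in neq_sr].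
rewrite /cofactor (det_row0 (i := r')) ?mulr0 ?mul0r // => m.
by rewrite !mxE -Er Mr lift_eqF.
Qed.

Definition replace_col n (M : 'M[R]_n) (i l : 'I_n) :=
  \matrix_(a, b) M a (if b == i then l else b).

Definition set_row_delta n (r j : 'I_n) (M : 'M[R]_n) :=
  \matrix_(a, b) if a == r then (b == j)%:R else M a b.

Lemma rcomm_replace_col n (M : 'M[R]_n) i l :
  row_commuting M -> row_commuting (replace_col M i l).
Proof. by move=> commM a b k m neq_ab; rewrite !mxE commM. Qed.

Lemma rcomm_set_row_delta n (M : 'M[R]_n) r j :
  row_commuting M -> row_commuting (set_row_delta r j M).
Proof.
move=> commM a b k m neq_ab; rewrite !mxE.
have [_|neq_ar] := eqVneq a r; first exact/esym/commr_nat.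
have [_|neq_br] := eqVneq b r; [exact: commr_nat | exact: commM].
Qed.

Lemma replace_col_id n (M : 'M[R]_n) i : replace_col M i i = M.
Proof. by apply/matrixP => a b; rewrite mxE; case: eqP => [->|]. Qed.

Lemma cofactor_replace_col n (M : 'M[R]_n) i l s :
  cofactor (replace_col M i l) s i = cofactor M s i.
Proof. by apply: eq_cofactor_col => a b /negbTE neq_bi; rewrite mxE neq_bi. Qed.

Lemma det_replace_col_eq0 n (M : 'M[R]_n) i l :
  i != l -> \det (replace_col M i l) = 0.
Proof.
move=> neq_il; apply: determinant_alternate_col neq_il _ => a.
by rewrite !mxE eqxx; case: eqP => [->|].
Qed.

Lemma det_set_row_delta_rcomm n (M : 'M[R]_n) r j :
  row_commuting M -> \det (set_row_delta r j M) = cofactor M r j.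
Proof.
move=> commM.
rewrite (det_delta_row_rcomm (r := r) (j := j) (rcomm_set_row_delta r j commM)).
  by apply: eq_cofactor_row => a b /negbTE neq_ar; rewrite mxE neq_ar.
by move=> k; rewrite mxE eqxx.
Qed.

Lemma mul_adj_mx_rcomm n (M : 'M[R]_n) :
  row_commuting M -> \adj M *m M = (\det M)%:M.
Proof.
move=> commM; apply/matrixP => i l; rewrite !mxE.
have -> : \sum_k \adj M i k * M k l = \det (replace_col M i l).
  rewrite (expand_det_col_rcomm i (rcomm_replace_col _ _ commM)).
  by apply: eq_bigr => k _; rewrite cofactor_replace_col !mxE eqxx.
have [<-|neq_il] := eqVneq i l; first by rewrite replace_col_id.
by rewrite det_replace_col_eq0.
Qed.

End RowCommutingDeterminant.

Lemma rinvmx_adj_rcomm (R : unitRingType) n (M N : 'M[R]_n) :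
  row_commuting M -> \det M \is a GRing.unit -> M *m N = 1%:M ->
  N = (\det M)^-1 *: \adj M.
Proof.
move=> commM unitD MN1.
have linv : ((\det M)^-1 *: \adj M) *m M = 1%:M.
  by rewrite -scalemxAl mul_adj_mx_rcomm // scale_scalar_mx mulVr.
by rewrite -[LHS]mul1mx -linv -mulmxA MN1 mulmx1.
Qed.

Section CofactorRowCommute.
Variables (R : pzRingType) (n : nat) (B : 'M[R]_n) (x : R) (r i j : 'I_n).
Hypotheses (commB : row_commuting B) (B_rinv : B *m (x *: \adj B) = 1%:M).
Hypothesis neq_ij : i != j.

Let H k := set_row_delta r j (replace_col B i k).

Lemma cramer_sum_eq0 : \sum_k \det (H k) * (x * cofactor B r k) = 0.
Proof.
have commH k : row_commuting (H k).
  exact/rcomm_set_row_delta/rcomm_replace_col.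
have cofH k s : cofactor (H k) s i = cofactor (set_row_delta r j B) s i.
  by apply: eq_cofactor_col => a b /negbTE neq_bi; rewrite !mxE neq_bi.
under eq_bigr => k _ do rewrite (expand_det_col_rcomm i (commH k)) mulr_suml.
rewrite exchange_big /=; apply: big1 => s _.
have [->|neq_sr] := eqVneq s r.
  by apply: big1 => k _; rewrite !mxE eqxx (negbTE neq_ij) mulr0 mul0r.
under eq_bigr => k _ do rewrite cofH !mxE (negbTE neq_sr) eqxx -mulrA.
rewrite -big_distrr /=.
have Bsr : \sum_k B s k * (x * cofactor B r k) = 0.
  have := congr1 (fun M : 'M[R]_n => M s r) B_rinv.
  rewrite !mxE (negbTE neq_sr) mulr0n => Bsr; apply: etrans Bsr.
  by apply: eq_bigr => k _; rewrite !mxE.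
by rewrite Bsr mulr0.
Qed.

Lemma det_cramer_other k : k != i -> k != j -> \det (H k) = 0.
Proof.
move=> neq_ki /negbTE neq_kj.
apply: (determinant_alternate_col (i1 := i) (i2 := k)); first by rewrite eq_sym.
by move=> a; rewrite !mxE eqxx (negbTE neq_ij) neq_kj (negbTE neq_ki).
Qed.

Lemma det_cramer_i : \det (H i) = cofactor B r j.
Proof. by rewrite /H replace_col_id det_set_row_delta_rcomm. Qed.

Lemma det_cramer_j : \det (H j) = - cofactor B r i.
Proof.
have swapH : col_perm (tperm i j) (H j) = set_row_delta r i (replace_col B i j).
  apply/matrixP => a b; rewrite !mxE.
  case: tpermP => [->|->|/eqP/negbTE neq_bi /eqP/negbTE neq_bj].
  - by rewrite !eqxx if_same.
  - by rewrite !eqxx if_same (eq_sym i j).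
  - by rewrite neq_bi neq_bj.
have := det_col_perm (H j) (tperm i j).
rewrite swapH det_set_row_delta_rcomm; last exact: rcomm_replace_col.
by rewrite cofactor_replace_col odd_tperm neq_ij mulN1r => ->; rewrite opprK.
Qed.

End CofactorRowCommute.

Lemma cofactor_row_commute (R : pzRingType) n (B : 'M[R]_n) (x : R) r i j :
  row_commuting B -> B *m (x *: \adj B) = 1%:M ->
  cofactor B r i * x * cofactor B r j = cofactor B r j * x * cofactor B r i.
Proof.
move=> commB B_rinv; have [->//|neq_ij] := eqVneq i j.
have := cramer_sum_eq0 r commB B_rinv neq_ij.
rewrite (bigD1 i) // (bigD1 j) /=; last by rewrite eq_sym.
rewrite big1 => [|k /andP[neq_ki neq_kj]]; last by rewrite det_cramer_other ?mul0r.
rewrite addr0 det_cramer_i // det_cramer_j // mulNr => /eqP.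
by rewrite subr_eq0 -!mulrA => /eqP.
Qed.

Theorem mainTheorem2 (A : unitAlgType CC) (g : nat) (B : 'M[A]_g)
  (Hcomm : forall (i j k l : 'I_g), i != j -> B i k * B j l = B j l * B i k)
  (HD : \det B \is a GRing.unit)
  (Binv : 'M[A]_g) (HBl : B *m Binv = 1%:M) (HBr : Binv *m B = 1%:M) :
  (forall i j : 'I_g, Binv i j = (\det B)^-1 * cofactor B j i) /\
  (forall i j r : 'I_g, Binv i r * Binv j r = Binv j r * Binv i r) /\
  (forall i j r : 'I_g,
     cofactor B r i * (\det B)^-1 * cofactor B r j
     = cofactor B r j * (\det B)^-1 * cofactor B r i).
Proof.
have BinvE := rinvmx_adj_rcomm Hcomm HD HBl.
have entryE i j : Binv i j = (\det B)^-1 * cofactor B j i by rewrite BinvE !mxE.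
have B_rinv : B *m ((\det B)^-1 *: \adj B) = 1%:M by rewrite -BinvE.
have cofC i j r := cofactor_row_commute r i j Hcomm B_rinv.
split=> //; split=> // i j r.
rewrite !entryE -!(mulrA (\det B)^-1) (mulrA (cofactor B r i)).
by rewrite (mulrA (cofactor B r j)) cofC.
Qed.
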